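(* Let $q$ be a prime power and let $t$ be a positive integer with $t < q$. Then, with $q$ and $t$ fixed and $n \to \infty$, $$\mathrm{M}_t(n,q) = \Omega\left(q^{\,n\left(1-\frac{2}{t^2+t}\right)}\right),$$ where $\mathrm{M}_t(n,q)$ denotes the maximum size of a $t$-line evasive subset of $\mathbb{F}_q^n$.
   Context: $\mathbb{F}_q$ is the finite field with $q$ elements and $\mathbb{F}_q^n$ is regarded as the affine space $\mathrm{AG}(n,q)$. An affine line in $\mathbb{F}_q^n$ is a set $\{ax+b : x \in \mathbb{F}_q\}$ with $a,b\in\mathbb{F}_q^n$, $a \neq 0$. A subset $K \subseteq \mathbb{F}_q^n$ is called $t$-line evasive if every affine line of $\mathbb{F}_q^n$ intersects $K$ in at most $t$ points. *)

(* Defs.v *)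
From mathcomp Require Import all_boot all_algebra.

Set Implicit Arguments.
Unset Strict Implicit.
Unset Printing Implicit Defensive.

Import GRing.Theory.
Local Open Scope ring_scope.

Definition affine_line (F : finFieldType) (n : nat) (a b : 'rV[F]_n) :
    {set 'rV[F]_n} :=
  [set x *: a + b | x : F].

Definition line_evasive (F : finFieldType) (n t : nat) (K : {set 'rV[F]_n}) :
    bool :=
  [forall a : 'rV[F]_n, forall b : 'rV[F]_n,
    (a != 0) ==> (#|affine_line a b :&: K| <= t)%N].

Definition max_line_evasive (F : finFieldType) (t n : nat) : nat :=
  \max_(K : {set 'rV[F]_n} | line_evasive t K) #|K|.

(* Main.v *)
Require Import Defs.
From mathcomp Require Import all_boot all_order all_algebra.
From mathcomp Require Import all_fingroup cyclic all_field.
From mathcomp Require Import all_classical all_reals all_analysis.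
From mathcomp Require Import lra.
Import numFieldNormedType.Exports.
Import Order.TTheory GRing.Theory FinRing.Theory Num.Theory.
Import VectorInternalTheory.

(* Put N = 1 + 2 + ... + t and let E be the extension of F of degree m, where
   m is about n / N.  For y = (y_1, ..., y_t) with y_k in the extension E_k of
   degree k of E, let f(y) be the sum of the norms N_{E_k/E}(y_k).  On an
   F-line of direction a, N_{E_k/E}(y_k) is a polynomial of degree exactly k if
   a_k != 0 and is constant otherwise, so f is a nonconstant polynomial of
   degree at most t and every fibre of f is t-line evasive.  One of the
   q^m fibres in F^n has at least q^(n - m) points. *)

Set Implicit Arguments.
Unset Strict Implicit.
Unset Printing Implicit Defensive.

Local Open Scope ring_scope.

Lemma natr_card_finField (F : finFieldType) : #|F|%:R = 0 :> F.
Proof. by rewrite -zmodXgE -cardsT expg_cardG ?inE. Qed.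

(** The derivative is the nonzero constant -1. *)
Lemma separable_XnsubX (F : fieldType) n :
  n%:R = 0 :> F -> separable_poly ('X^n - 'X : {poly F}).
Proof.
move=> n0; rewrite separable_poly.unlock derivB derivXn derivX -mulr_natr.
by rewrite -polyC_natr n0 mulr0 sub0r -(scaleN1r 1) coprimepZr ?coprimep1 ?oppr_eq0 ?oner_eq0.
Qed.

(** Take for [L] a splitting field of 'X^m - 'X with m = #|F|^k. By separability this polynomial has
    m distinct roots; they exhaust [L], so #|L| = #|F|^k, which fixes the dimension. *)
Lemma fieldExt_exists (F : finFieldType) k :
  (0 < k)%N -> exists L : fieldExtType F, dim L = k.
Proof.
move=> k_gt0; pose m := (#|F| ^ k)%N.
have m_gt1 : (1 < m)%N by rewrite -[1%N](exp1n k) ltn_exp2r ?finNzRing_gt1.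
have sz_q (R : fieldType) : size ('X^m - 'X : {poly R}) = m.+1.
  by rewrite size_polyDl size_polyXn // size_polyN size_polyX.
have /FinSplittingFieldFor[/= L] : 'X^m - 'X != 0 :> {poly F}.
  by rewrite -size_poly_eq0 sz_q.
rewrite rmorphB rmorphXn /= map_polyX => -[zs Dq defL].
have m0 : m%:R = 0 :> L.
  by rewrite natrX -[#|F|%:R](rmorph_nat (in_alg L)) natr_card_finField rmorph0
    expr0n gtn_eqF.
have Uzs : uniq zs.
  by rewrite -separable_prod_XsubC -(eqp_separable Dq) separable_XnsubX.
have size_zs : size zs = m.
  by apply: succn_inj; rewrite -(size_prod_XsubC _ id) -(eqp_size Dq) sz_q.
have in_zs z : (z \in zs) = (z ^+ m == z).
  by rewrite -root_prod_XsubC -(eqp_root Dq) rootE !hornerE subr_eq0.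
(* The roots of 'X^m - 'X are the fixed points of the k-th power of Frobenius,
   hence form a subfield, which must be all of L. *)
have [a _ Da] := finField_galois_generator (sub1v {:L}%AS).
have ak z : (a ^+ k)%g z = z ^+ m.
  rewrite /m; elim: (k) => [|i IHi]; first by rewrite gal_id.
  by rewrite expgSr expnSr exprM -IHi galM ?memvf // Da ?memvf //= dimv1 expn1.
have fixL : (<<1 & zs>> <= fixedField [set (a ^+ k)%g])%VS.
  apply/Fadjoin_seqP; split=> [|z]; first exact: sub1v.
  rewrite in_zs => /eqP zm; apply/fixedFieldP=> [|_ /set1P->]; first exact: memvf.
  by rewrite ak.
have all_zs z : z \in zs.
  have /(subvP fixL)/fixedFieldP : z \in <<1 & zs>>%VS by rewrite defL memvf.
  by move=> /(_ (memvf _) _ (set11 _)); rewrite ak in_zs => ->.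
have cardL : #|finvect_type L| = m.
  pose zs' : seq (finvect_type L) := zs; have /card_uniqP Uzs' : uniq zs' by [].
  by rewrite -size_zs -[RHS]Uzs'; apply: eq_card => z; rewrite [RHS]all_zs.
exists L; apply/eqP; rewrite -(eqn_exp2l _ _ (finNzRing_gt1 F)) -/m -cardL.
by rewrite -[dim L]dimvf -(card_vspace (T := finvect_type L)) card_vspacef.
Qed.

Lemma horner_det (R : comNzRingType) n (A : 'M[{poly R}]_n) x :
  (\det A).[x] = \det (map_mx (horner^~ x) A).
Proof. exact: (esym (det_map_mx (horner_eval x) A)). Qed.

(** Factoring out A leaves det(x I + A^-1 B), a monic characteristic polynomial in x; the scalar det
    A is nonzero, so the degree is exactly n. *)
Lemma char_poly_pencil (R : fieldType) n (A B : 'M[R]_n) : A \in unitmx ->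
  exists2 p : {poly R}, size p = n.+1 & forall x, \det (x *: A + B) = p.[x].
Proof.
move=> uA; exists (\det A *: char_poly (- (invmx A *m B))) => [|x].
  by rewrite size_scale ?size_char_poly // -unitfE.
rewrite hornerZ horner_det -det_mulmx; congr (\det _).
suff -> : map_mx (horner^~ x) (char_poly_mx (- (invmx A *m B)))
  = x%:M + invmx A *m B.
  by rewrite mulmxDr mulmxA mulmxV // mul1mx -scalemx1 -scalemxAr mulmx1.
by apply/matrixP=> i j; rewrite !mxE !hornerE hornerMn hornerX opprK.
Qed.

(** The norm of z is the determinant of [M z], the matrix of multiplication by z. It is linear in z,
    and invertible for z != 0 with inverse [M z^-1], so a line yields a pencil with invertible
    leading matrix. *)
Lemma norm_form_exists (E : fieldType) (L : fieldExtType E) :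
  exists N : 'rV[E]_(dim L) -> E, forall a b, a != 0 ->
    exists2 p : {poly E}, size p = (dim L).+1 & forall x, N (x *: a + b) = p.[x].
Proof.
pose M (z : L) : 'M[E]_(dim L) := lin1_mx (v2r \o amulr z \o r2v).
have mulM v z : v *m M z = v2r (r2v v * z).
  by rewrite mul_rV_lin1 /= lfunE.
have eqM (A B : 'M[E]_(dim L)) : (forall v : 'rV_(dim L), v *m A = v *m B) -> A = B.
  by move=> eqAB; apply/row_matrixP=> i; rewrite !rowE.
have unitM z : z != 0 -> M z \in unitmx.
  move=> z0; suff /mulmx1_unit[] : M z *m M z^-1 = 1%:M by [].
  by apply: eqM => v; rewrite mulmxA !mulM v2rK mulmx1 mulfK ?r2vK.
exists (fun v => \det (M (r2v v))) => a b a0.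
have [|p sz_p Dp] := @char_poly_pencil _ _ (M (r2v a)) (M (r2v b)).
  by apply: unitM; apply: contraNneq a0 => z0; rewrite -(r2vK a) z0 linear0.
exists p => // x; rewrite -Dp; congr (\det _); apply: eqM => v.
by rewrite linearP mulmxDr -scalemxAr !mulM mulrDr -scalerAr linearP.
Qed.

(** Cutting a vector into [dim L] blocks, each read as an element of E, is an injective F-linear map
    [g], so it sends F-lines into E-lines. *)
Lemma relative_norm_form_exists (F : fieldType) (E : fieldExtType F)
    (L : fieldExtType E) :
  exists N : 'rV[F]_(dim L * dim E) -> E, forall a b, a != 0 ->
    exists2 p : {poly E}, size p = (dim L).+1 &
      forall x, N (x *: a + b) = p.[x%:A].
Proof.
have [N lineN] := norm_form_exists L.
pose g (v : 'rV[F]_(dim L * dim E)) : 'rV[E]_(dim L) :=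
  \row_i r2v (row i (vec_mx v)).
have gD x a b : g (x *: a + b) = x%:A *: g a + g b.
  by apply/rowP=> i; rewrite !mxE !linearP /= mulr_algl.
exists (N \o g) => a b a0.
have [|p sz_p Dp] := lineN (g a) (g b); last first.
  by exists p => // x; rewrite /= gD Dp.
apply: contraNneq a0 => ga0; rewrite -(vec_mxK a); apply/eqP.
suff -> : vec_mx a = 0 by rewrite linear0.
apply/row_matrixP=> i; rewrite row0 -[LHS]r2vK.
by have /rowP/(_ i) := ga0; rewrite !mxE => ->; rewrite linear0.
Qed.

(** The degree lies between 1 and t; the lower bound keeps a line out of any single fibre, up to t
    points. *)
Definition polynomial_on_lines (F : fieldType) (E : fieldExtType F) (n t : nat)
    (f : 'rV[F]_n -> E) :=
  forall a b, a != 0 -> exists2 p : {poly E}, (1 < size p <= t.+1)%N &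
    forall x, f (x *: a + b) = p.[x%:A].

Lemma polynomial_on_lines_exists (F : finFieldType) (E : fieldExtType F) t :
  exists f : 'rV[F]_(\sum_(k < t.+1) k * dim E) -> E, polynomial_on_lines t f.
Proof.
elim: t => [|t [f linef]].
  rewrite big_ord1 mul0n; exists (fun=> 0) => a b.
  (* In dimension 0 there is no nonzero direction. *)
  by rewrite (thinmx0 a) eqxx.
have [L dimL] := @fieldExt_exists (finvect_type E : finFieldType) _ (ltn0Sn t).
have [N lineN] := @relative_norm_form_exists F E L.
rewrite big_ord_recr /= -[X in (X * dim E)%N]dimL.
(* The new block carries a norm of degree t + 1. If a vanishes there, only a constant is added to a
   nonconstant polynomial; otherwise the norm dominates the old part, of degree at most t, and no
   cancellation occurs. *)
exists (fun v => f (lsubmx v) + N (rsubmx v)) => a b a0.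
have [ra0|ra0] := eqVneq (rsubmx a) 0.
  have [|p sz_p Dp] := linef (lsubmx a) (lsubmx b).
    by apply: contraNneq a0 => la0; rewrite -(hsubmxK a) la0 ra0 row_mx0.
  have sz_c : (size (N (rsubmx b))%:P < size p)%N.
    by rewrite (leq_ltn_trans (size_polyC_leq1 _)) //; case/andP: sz_p.
  exists (p + (N (rsubmx b))%:P) => [|x].
    by rewrite size_polyDl //; case/andP: sz_p => -> /leqW.
  by rewrite hornerD hornerC !linearP /= Dp ra0 scaler0 add0r.
have [p sz_p Dp] := lineN _ (rsubmx b) ra0.
have [r sz_r Dr] : exists2 r : {poly E}, (size r <= t.+1)%N &
    forall x, f (x *: lsubmx a + lsubmx b) = r.[x%:A].
  have [la0|/(linef _ (lsubmx b))[r /andP[_ sz_r] Dr]] := eqVneq (lsubmx a) 0.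
    exists (f (lsubmx b))%:P => [|x]; last by rewrite hornerC la0 scaler0 add0r.
    exact: leq_trans (size_polyC_leq1 _) _.
  by exists r.
exists (p + r) => [|x]; last by rewrite hornerD !linearP /= Dr Dp addrC.
by rewrite size_polyDl sz_p dimL ?ltnS ?leqnn.
Qed.

(** Padding with zeros maps lines to lines; this handles dimensions not of the form
    [\sum_(k < t.+1) k * m]. *)
Lemma polynomial_on_lines_restrict (F : fieldType) (E : fieldExtType F) n N t
    (f : 'rV[F]_N -> E) : (n <= N)%N -> polynomial_on_lines t f ->
  exists g : 'rV[F]_n -> E, polynomial_on_lines t g.
Proof.
move=> /subnKC eqN; case: _ / eqN f => f linef.
exists (fun v => f (row_mx v 0)) => a b a0.
have [|p sz_p Dp] := linef (row_mx a 0) (row_mx b 0).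
  by apply: contraNneq a0 => /(congr1 lsubmx); rewrite row_mxKl linear0 => ->.
by exists p => // x; rewrite -Dp scale_row_mx add_row_mx scaler0 addr0.
Qed.

(** The points of a line in the fibre come from roots in F of p - c, which is nonzero of degree at
    most t because p is nonconstant. *)
Lemma fiber_line_evasive (F : finFieldType) (L : fieldExtType F) n t
    (E := finvect_type L) (f : 'rV[F]_n -> E) c :
  polynomial_on_lines t f -> line_evasive t [set v | f v == c].
Proof.
move=> linef; apply/forallP=> a; apply/forallP=> b; apply/implyP=> a0.
have [p /andP[sz_gt1 sz_le] Dp] := linef a b a0.
have sz_c : (size (- c%:P) < size p)%N.
  by rewrite size_polyN (leq_ltn_trans (size_polyC_leq1 _)).
pose X := [set x : F | p.[x%:A] == c].
have -> : affine_line a b :&: [set v | f v == c] = [set x *: a + b | x in X].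
  apply/setP=> v; rewrite !inE; apply/andP/imsetP.
    by move=> [/imsetP[x _ ->]]; rewrite Dp => Xx; exists x; rewrite ?inE.
  by move=> [x]; rewrite inE => Xx ->; rewrite Dp; split=> //; apply: imset_f.
apply: leq_trans (leq_imset_card _ _) _.
rewrite -ltnS (leq_trans _ sz_le) // -(size_polyDl sz_c) cardE.
rewrite -(size_map (in_alg E)) max_poly_roots //.
- by rewrite -size_poly_gt0 size_polyDl // ltnW.
- apply/allP=> _ /mapP[x + ->]; rewrite mem_enum inE => /eqP Xx.
  by rewrite rootE hornerD hornerN hornerC Xx subrr.
- by rewrite map_inj_uniq ?enum_uniq //; apply: fmorph_inj.
Qed.

(** Pigeonhole: the fibres of f, indexed by L, partition the space. *)
Lemma card_le_max_line_evasive (F : finFieldType) (L : fieldExtType F) n t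
    (f : 'rV[F]_n -> L) : polynomial_on_lines t f ->
  (#|F| ^ n <= #|F| ^ dim L * max_line_evasive F t n)%N.
Proof.
move=> linef; pose E := finvect_type L.
have <- : #|E| = (#|F| ^ dim L)%N.
  by rewrite -[dim L]dimvf -(card_vspace (T := E)) card_vspacef.
have -> : (#|F| ^ n = \sum_(c : E) #|[set v | f v == c]|)%N.
  rewrite -[n in LHS]mul1n -card_mx -sum1_card.
  rewrite (partition_big (f : _ -> E) xpredT) //=; apply: eq_bigr => c _.
  by rewrite -sum1_card; apply: eq_bigl => v; rewrite !inE.
rewrite -sum_nat_const leq_sum // => c _.
exact/leq_bigmax_cond/fiber_line_evasive.
Qed.

Lemma max_line_evasive_bound (F : finFieldType) t m n :
  (0 < m)%N -> (n <= \sum_(k < t.+1) k * m)%N ->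
  (#|F| ^ n <= #|F| ^ m * max_line_evasive F t n)%N.
Proof.
move=> /(fieldExt_exists F)[L <-] le_n.
have [f /(polynomial_on_lines_restrict le_n)[g lineg]] :=
  polynomial_on_lines_exists L t.
exact: card_le_max_line_evasive lineg.
Qed.

Local Open Scope classical_set_scope.
Local Open Scope ring_scope.

Theorem theorem1p1 (R : realType) (F : finFieldType) (q t : nat)
    (hF : #|F| = q) (ht0 : (0 < t)%N) (htq : (t < q)%N) :
  (fun n : nat => (max_line_evasive F t n)%:R : R^o) \is
    'Omega_\oo (fun n : nat =>
      q%:R `^ (n%:R * (1 - 2 / (t%:R ^+ 2 + t%:R))) : R^o).
Proof.
have q_ge1 : 1 <= q%:R :> R by rewrite ler1n (leq_trans _ htq).
have q_gt0 : 0 < q%:R :> R by rewrite (lt_le_trans _ q_ge1).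
pose N := 'C(t.+1, 2); have N_gt0 : (0 < N)%N by rewrite bin_gt0 ltnS.
have NE : 2 / (t%:R ^+ 2 + t%:R) = N%:R^-1 :> R.
  have : (t%:R ^+ 2 + t%:R = 2 * N%:R :> R).
    rewrite -natrX -natrD -natrM; congr _%:R.
    by rewrite -mul_bin_diag bin1 mulSn addnC.
  by move=> ->; rewrite invfM mulrA divff ?mul1r // pnatr_eq0.
(* Since m = n %/ N + 1 exceeds n / N by at most 1, rounding costs at most one factor q. The
   successor also keeps m positive when n < N. *)
rewrite qualifE; apply/asboolP; exists q%:R^-1; first by rewrite invr_gt0.
apply: nearW => n; pose m := (n %/ N).+1.
rewrite NE ger0_norm ?powR_ge0 // ger0_norm //.
have le_n : (n <= \sum_(k < t.+1) k * m)%N.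
  rewrite -big_distrl /= -(big_mkord xpredT id) bin2_sum mulnC.
  exact/ltnW/ltn_ceil.
have := max_line_evasive_bound F (ltn0Sn _) le_n; rewrite hF => bound.
rewrite -(@ler_pM2l _ (q%:R ^+ m)) ?exprn_gt0 //.
have {bound} : q%:R ^+ n <= q%:R ^+ m * (max_line_evasive F t n)%:R :> R.
  by rewrite -!natrX -natrM ler_nat.
apply: le_trans; rewrite mulrA exprSr mulfK ?gt_eqF //.
rewrite -!powR_mulrn ?(ltW q_gt0) // -powRD ?(gt_eqF q_gt0) ?implybT //.
apply: ler_powR => //.
have : (n %/ N)%:R <= n%:R / N%:R :> R.
  by rewrite ler_pdivlMr ?ltr0n // -natrM ler_nat leq_trunc_div.
lra.
Qed.
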